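(* Let $X$ be a set and $S$ a family of subsets of $X$. Let $\mathcal{T}^+$ (resp. $\mathcal{T}^-$) be the topology on $S$ having as a subbase the family of all sets $U_x^+=\{p\in S: x\notin p\}$ (resp. $U_x^-=\{p\in S: x\in p\}$), $x\in X$, and suppose that the bitopological space $(S,\mathcal{T}^+,\mathcal{T}^-)$ is an abstract spectrum. Then there exist a distributive lattice $L$ with $0$ and $1$ and a function $\varphi:X\to L$ such that: (i) the set $\varphi(X)$ generates $L$; (ii) $\varphi^{-1}(q)\in S$ for every $q\in\mathrm{spec}(L)$; (iii) $\Phi:\mathrm{spec}(L)\to S$, $q\mapsto\varphi^{-1}(q)$, is an $\mathbf{S}$-isomorphism; (iv) if $L'$ is a distributive lattice with $0$ and $1$ and $\theta:X\to L'$ is a function such that (1) $\theta^{-1}(q)\in S$ for every $q\in\mathrm{spec}(L')$, and (2) $\Theta:\mathrm{spec}(L')\to S$, $q\mapsto\theta^{-1}(q)$, is an $\mathbf{S}$-morphism, then there exists a unique lattice homomorphism $l:L\to L'$ with $l\circ\varphi=\theta$; (v) if $L_1$ is a distributive lattice with $0$ and $1$ and $\varphi_1:X\to L_1$ is a function such that (1') $\varphi_1^{-1}(q)\in S$ for every $q\in\mathrm{spec}(L_1)$, and (2') $\Phi_1:\mathrm{spec}(L_1)\to S$, $q\mapsto\varphi_1^{-1}(q)$, is an $\mathbf{S}$-isomorphism, then there exists a unique lattice isomorphism $l:L\to L_1$ with $l\circ\varphi=\varphi_1$; (vi) $\varphi$ is an injection if and only if for any two different points $x,y$ of $X$ there exists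 a $p\in S$ containing exactly one of them.
   Context: Compact means that every open cover has a finite subcover (no separation axiom is included). The topology with a given family as subbase is the one generated by that family (the whole set is the empty intersection). A bitopological space $(S,\mathcal{T}^+,\mathcal{T}^-)$ is a set with two topologies. Put $\mathcal{L}^+=\{U\in\mathcal{T}^+: S\setminus U\in\mathcal{T}^-\}$ and $\mathcal{L}^-=\{U\in\mathcal{T}^-: S\setminus U\in\mathcal{T}^+\}$. A non-empty bitopological space is an abstract spectrum if: (SP1) $\mathcal{L}^+$ is a base for $\mathcal{T}^+$ and $\mathcal{L}^-$ is a base for $\mathcal{T}^-$; (SP2) if $F\subseteq S$ and $S\setminus F\in\mathcal{T}^+$ (resp. $S\setminus F\in\mathcal{T}^-$) then $F$ is a compact subset of $(S,\mathcal{T}^-)$ (resp. of $(S,\mathcal{T}^+)$); (SP3) at least one of $(S,\mathcal{T}^+)$, $(S,\mathcal{T}^-)$ is a $T_0$-space. An $\mathbf{S}$-morphism between abstract spectra is a function continuous with respect to both the $+$ topologies and the $-$ topologies; an $\mathbf{S}$-isomorphism is an isomorphism in the resulting category $\mathbf{S}$, i.e. a bijection that is an $\mathbf{S}$-morphism together with its inverse. Lattices have $0$ and $1$ (not required to be distinct), lattice homomorphisms preserve $0$ and $1$, and ''generates'' means as a lattice with $0$ and $1$. For a distributive lattice $L$, an ideal is a subset containing $0$, closed under $\vee$ and downward closed; a prime ideal is an ideal $p$ with $1\notin p$ such that $a\wedge b\in p$ implies $a\in p$ or $b\in p$. $\mathrm{spec}(L)$ is the set of all prime ideals of $L$, regarded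 as an abstract spectrum: its topology $\mathcal{T}^+$ is the Stone topology $\{\{p: I\not\subseteq p\}: I \text{ an ideal of } L\}$ (equivalently, the topology generated by the sets $\{p: a\notin p\}$, $a\in L$), and its topology $\mathcal{T}^-$ is generated by the sets $\{p: a\in p\}$, $a\in L$. *)

(* Defs.v *)
From HB Require Import structures.
From mathcomp Require Import all_boot all_order.
From mathcomp Require Import all_classical.
From mathcomp Require Import topology.

Set Implicit Arguments.
Unset Strict Implicit.
Unset Printing Implicit Defensive.

Local Open Scope classical_set_scope.

(* A set with two topologies; [Topological T] is the type of topologicalType
   structures on the carrier T. *)
Structure bitopSpace := Bitop {
  bicarrier :> Type;
  plus_topology : Topological bicarrier;
  minus_topology : Topological bicarrier }.

Definition plusT (B : bitopSpace) : topologicalType :=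
  Topological.Pack (plus_topology B).

Definition minusT (B : bitopSpace) : topologicalType :=
  Topological.Pack (minus_topology B).

Definition plus_open (B : bitopSpace) : set (set B) := @open (plusT B).

Definition minus_open (B : bitopSpace) : set (set B) := @open (minusT B).

Definition Lplus (B : bitopSpace) : set (set B) :=
  [set U | plus_open U /\ minus_open (~` U)].

Definition Lminus (B : bitopSpace) : set (set B) :=
  [set U | minus_open U /\ plus_open (~` U)].

Definition SP1 (B : bitopSpace) : Prop :=
  @basis (plusT B) (Lplus (B := B)) /\ @basis (minusT B) (Lminus (B := B)).

(* [cover_compact] is the open-cover definition, with no separation axiom; the
   library only identifies it with the filter-based [compact] on pointed
   spaces. *)
Definition SP2 (B : bitopSpace) : Prop :=
  forall F : set B,
    (plus_open (~` F) -> @cover_compact (minusT B) F) /\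
    (minus_open (~` F) -> @cover_compact (plusT B) F).

Definition SP3 (B : bitopSpace) : Prop :=
  kolmogorov_space (plusT B) \/ kolmogorov_space (minusT B).

Definition abstract_spectrum (B : bitopSpace) : Prop :=
  [/\ [set: B] !=set0, SP1 B, SP2 B & SP3 B].

(* Morphisms are defined between arbitrary bitopological spaces: the space of
   prime ideals of the lattice with 0 = 1 is empty, hence not an abstract
   spectrum, and is nevertheless allowed as a source. *)
Definition S_morphism (B C : bitopSpace) (f : B -> C) : Prop :=
  continuous (f : plusT B -> plusT C) /\ continuous (f : minusT B -> minusT C).

Definition S_isomorphism (B C : bitopSpace) (f : B -> C) : Prop :=
  S_morphism f /\
  exists g : C -> B, [/\ cancel f g, cancel g f & S_morphism g].

Definition generated_space (T : choiceType) (G : set (set T)) : Type := T.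

HB.instance Definition _ (T : choiceType) (G : set (set T)) :=
  Choice.copy (generated_space G) T.
HB.instance Definition _ (T : choiceType) (G : set (set T)) :=
  isSubBaseTopological.Build (generated_space G) G id.

Definition generated_topology (T : choiceType) (G : set (set T)) :
  Topological T := Topological.on (generated_space G).

Definition family_plus (X : Type) (S : set (set X)) (x : X) : set S :=
  [set p | ~ val p x].

Definition family_minus (X : Type) (S : set (set X)) (x : X) : set S :=
  [set p | val p x].

Definition family_bitop (X : Type) (S : set (set X)) : bitopSpace :=
  Bitop (generated_topology (range (@family_plus X S)))
        (generated_topology (range (@family_minus X S))).

Section Lattices.
Context {d : Order.disp_t} (L : tbDistrLatticeType d).
Implicit Types (I J p A G : set L).

Definition is_ideal I : Prop :=
  [/\ I \bot%O,
      forall a b, I a -> I b -> I (a `|` b)%O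
    & forall a b, (a <= b)%O -> I b -> I a].

Definition is_prime_ideal p : Prop :=
  [/\ is_ideal p, ~ p \top%O & forall a b, p (a `&` b)%O -> p a \/ p b].

Definition prime_ideals : set (set L) := [set p | is_prime_ideal p].

Definition is_sublattice01 A : Prop :=
  [/\ A \bot%O, A \top%O,
      forall a b, A a -> A b -> A (a `&` b)%O
    & forall a b, A a -> A b -> A (a `|` b)%O].

Definition lattice_generated_by G : Prop :=
  smallest is_sublattice01 G = [set: L].

Definition stone_set I : set prime_ideals := [set p | ~ (I `<=` val p)].

Definition stone_open : set (set prime_ideals) :=
  [set U | exists2 I, is_ideal I & U = stone_set I].

Lemma stone_openT : stone_open setT.
Proof.
exists setT; first by [].
by apply/seteqP; split=> // p _ /= /(_ \top%O Logic.I); have /set_mem[] := valP p.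
Qed.

Lemma stone_openI : setI_closed stone_open.
Proof.
move=> _ _ [I [I0 IU Id] ->] [J [J0 JU Jd] ->]; exists (I `&` J).
  split=> [//|a b [Ia Ja] [Ib Jb]|a b ab [Ib Jb]].
    by split; [exact: IU|exact: JU].
  by split; [exact: Id ab Ib|exact: Jd ab Jb].
apply/seteqP; split=> p /=.
  move=> [nIp nJp] sIJp.
  have [_ _ pp] := set_mem (valP p).
  apply: nIp => a Ia; apply: contrapT => npa; apply: nJp => b Jb.
  have [|//|//] := pp a b; apply: sIJp; split.
    by apply: Id Ia; exact: Order.MeetTheory.leIl.
  by apply: Jd Jb; exact: Order.MeetTheory.leIr.
move=> nIJp; split=> sp; apply: nIJp => a [Ia Ja]; exact: sp.
Qed.

Lemma stone_open_bigU (K : Type) (f : K -> set prime_ideals) :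
  (forall i, stone_open (f i)) -> stone_open (\bigcup_i f i).
Proof.
move=> fo.
pose gen := smallest is_ideal (\bigcup_(I in [set I | is_ideal I /\
  exists i, f i = stone_set I]) I).
exists gen.
  split=> [A [[A0 _ _] _]//|a b ga gb A hA|a b ab gb A hA].
    by have [[_ AU _] _] := hA; apply: AU; [exact: ga|exact: gb].
  by have [[_ _ Ad] _] := hA; apply: Ad ab _; exact: gb.
apply/seteqP; split=> p /=.
  move=> [i _]; have [I idI fiE] := fo i; rewrite fiE => nIp sgp; apply: nIp.
  move=> a Ia; apply: sgp => A [_]; apply; exists I => //.
  by split=> //; exists i.
move=> ngp; apply: contrapT => nU; apply: ngp.
have [idp _ _] := set_mem (valP p).
apply: smallest_sub => // a [I [idI [i fiE]] Ia].
by apply: contrapT => npa; apply: nU; exists i => //; rewrite fiE => /(_ a Ia).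
Qed.

Definition stone_space : Type := prime_ideals.

HB.instance Definition _ := Choice.copy stone_space prime_ideals.
HB.instance Definition _ := @isOpenTopological.Build stone_space stone_open
  stone_openT stone_openI stone_open_bigU.

Definition spec : bitopSpace :=
  @Bitop prime_ideals (Topological.on stone_space)
    (generated_topology (range (@family_minus L prime_ideals))).

End Lattices.

(* The library's {tblmorphism L -> L'} only asks for \bot and \top to be
   preserved, not for meets and joins. *)
Definition lattice_hom (d d' : Order.disp_t) (L : tbDistrLatticeType d)
    (L' : tbDistrLatticeType d') (l : L -> L') : Prop :=
  [/\ l \bot%O = \bot%O, l \top%O = \top%O,
      {morph l : a b / (a `&` b)%O} & {morph l : a b / (a `|` b)%O}].

Definition lattice_iso (d d' : Order.disp_t) (L : tbDistrLatticeType d)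
    (L' : tbDistrLatticeType d') (l : L -> L') : Prop :=
  lattice_hom l /\ bijective l.

Definition preimages_in (X : Type) (S : set (set X)) (d : Order.disp_t)
    (L : tbDistrLatticeType d) (theta : X -> L) : Prop :=
  forall q : spec L, S (theta @^-1` val q).

Definition preimage_map (X : Type) (S : set (set X)) (d : Order.disp_t)
    (L : tbDistrLatticeType d) (theta : X -> L) (h : preimages_in S theta) :
  spec L -> family_bitop S := fun q => SigSub (mem_set (h q)).

(* Main.v *)
(** Take for L the lattice of subsets of S generated by the sets U_x^+, and
  phi x = U_x^+.  A point p of S gives the prime ideal of all u in L with
  p not in u, and (SP2), used once for each topology, shows that every prime
  ideal arises in this way; hence spec L is S.  Given theta : X -> L', each u
  in L pulls back along Theta to a set of the form {q | a not in q}, and a is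
  determined by u because prime ideals separate the elements of L'; then l
  maps u to a.  When Theta is an isomorphism, the image in S of
  {q | a not in q} is open for T^+ and closed for T^-, hence a T^+-compact
  union of members of L, hence itself a member of L, so that l is onto. *)

Require Import Defs.
From HB Require Import structures.
From mathcomp Require Import all_boot all_order.
From mathcomp Require Import finmap all_classical.
From mathcomp Require Import topology.

Set Implicit Arguments.
Unset Strict Implicit.
Unset Printing Implicit Defensive.

Import Order.TTheory.
Local Open Scope classical_set_scope.

(** * Topologies given by a subbase, and compactness *)

Lemma generated_open (T : choiceType) (G : set (set T)) (U : set T) :
  G U -> @open (generated_space G) U.
Proof.
move=> GU; exists [set U]; last by rewrite bigcup_set1.
move=> _ ->; exists [fset U]%fset; first by move=> V /fset1P ->; exact: mem_set.
by rewrite set_fset1 bigcap_set1.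
Qed.

(** Preimages commute with unions and with finite intersections. *)
Lemma continuous_to_generated (Y : topologicalType) (T : choiceType)
    (G : set (set T)) (f : Y -> T) :
  (forall U, G U -> open (f @^-1` U)) ->
  continuous (f : Y -> generated_space G).
Proof.
move=> fG; apply/continuousP => A [D sD <-].
rewrite preimage_bigcup; apply: bigcup_open => i /sD [E sE <-].
rewrite preimage_bigcap bigcap_fset big_seq.
apply: (big_ind (@open Y)); [exact: openT|exact: openI|].
by move=> j /sE /set_mem; exact: fG.
Qed.

(** The union of a finite subcover stays in [F], so a single member of [F] covers [A]. *)
Lemma cover_compact_directed (T : topologicalType) (A : set T)
    (F : set (set T)) :
  cover_compact A -> F set0 -> setU_closed F -> F `<=` open ->
  A `<=` \bigcup_(U in F) U -> exists2 U, F U & A `<=` U.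
Proof.
move=> cA F0 FU Fo AF; have [D' sD' AD'] := cA _ F id Fo AF.
exists (\big[setU/set0]_(U <- D') U); last by rewrite -bigcup_fset.
rewrite big_seq; apply: (big_ind F) => [//|//|U /sD' /set_mem //].
Qed.

(** * Prime ideals of a distributive lattice *)

Section PrimeIdeals.
Context {d : Order.disp_t} (L : tbDistrLatticeType d).
Implicit Types a b c : L.

Lemma prime_idealP (q : spec L) : is_prime_ideal (val q).
Proof. exact: set_mem (valP q). Qed.

Lemma prime_ideal_bot (q : spec L) : val q \bot%O.
Proof. by have [[]] := prime_idealP q. Qed.

Lemma prime_ideal_top (q : spec L) : ~ val q \top%O.
Proof. by have [] := prime_idealP q. Qed.

Lemma prime_ideal_le (q : spec L) a b :
  (a <= b)%O -> val q b -> val q a.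
Proof. by have [[_ _ qD] _ _] := prime_idealP q; exact: qD. Qed.

Lemma prime_ideal_join (q : spec L) a b :
  val q (a `|` b)%O <-> val q a /\ val q b.
Proof.
split=> [qab|[qa qb]]; last by have [[_ + _] _ _] := prime_idealP q; exact.
by split; apply: prime_ideal_le qab; rewrite ?leUl ?leUr.
Qed.

Lemma prime_ideal_meet (q : spec L) a b :
  val q (a `&` b)%O <-> val q a \/ val q b.
Proof.
split=> [|[|]]; first by have [_ _] := prime_idealP q; exact.
- by apply: prime_ideal_le; exact: leIl.
- by apply: prime_ideal_le; exact: leIr.
Qed.

(* Zorn is applied to the possibly empty directed lower sets [A] with no [x]
   in [A] such that [a <= x `|` b]: the empty set gives the empty chain an upper
   bound, and [b] belongs to a maximal [A] automatically. *)
Lemma prime_ideal_separation a b :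
  ~~ (a <= b)%O -> exists2 q : spec L, val q b & ~ val q a.
Proof.
move=> nab.
pose P (A : set L) := [/\ forall x y, A x -> A y -> A (x `|` y)%O,
  forall x y, (x <= y)%O -> A y -> A x
  & forall x, A x -> ~~ (a <= x `|` b)%O].
have [F PF totF|M [[MU Md Mn] Mmax]] := @Zorn_bigcup L P.
  split=> [x y [A FA Ax] [B FB By]|x y xy [A FA Ay]|x [A FA Ax]].
  - have [AB|BA] := totF _ _ FA FB.
      by exists B => //; have [BU _ _] := PF _ FB; apply: BU => //; exact: AB.
    by exists A => //; have [AU _ _] := PF _ FA; apply: AU => //; exact: BA.
  - by exists A => //; have [_ Ad _] := PF _ FA; apply: Ad xy Ay.
  - by have [_ _] := PF _ FA; apply.
have M0 : M \bot%O.
  (* A lower set without [\bot] is empty, and the singleton of [\bot] would then properly enlarge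
     [M]. *)
  apply: contrapT => nM0; apply: (Mmax [set \bot%O]).
    split=> [x Mx|sM]; last by apply: nM0; exact: sM.
    by case: nM0; apply: Md Mx; exact: le0x.
  split=> [x y -> ->|x y|x ->]; rewrite ?joinxx //= ?join0x //.
  by move=> xy yE; move: xy; rewrite yE lex0 => /eqP.
(* any proper enlargement of the maximal M already reaches [a] *)
have Mgrow c : ~ M c -> exists2 x, M x & (a <= (x `|` c) `|` b)%O.
  move=> nMc; apply: contrapT => Nx.
  apply: (Mmax [set y | exists2 x, M x & (y <= x `|` c)%O]).
    split=> [x Mx|sM]; first by exists x; rewrite ?leUl.
    by apply: nMc; apply: sM; exists \bot%O; rewrite ?leUr.
  split=> [x y [u Mu xu] [v Mv yv]|x y xy [u Mu yu]|y [u Mu yu]].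
  - exists (u `|` v)%O; first exact: MU.
    rewrite leUx (le_trans xu) ?(le_trans yv) // leU2 // ?leUl //.
    exact: leUr.
  - by exists u => //; exact: le_trans yu.
  - apply/negP => ay; apply: Nx; exists u => //.
    by apply: le_trans ay _; rewrite leU2.
have Mb : M b.
  apply: contrapT => /Mgrow [x Mx]; rewrite -joinA joinxx.
  exact/negP/Mn.
have Mprime : is_prime_ideal M.
  split=> [|/Mn|c e Mce]; [by split| by rewrite join1x lex1 |].
  apply: contrapT => /not_orP[/Mgrow [x Mx ax] /Mgrow [y My ay]].
  (* Distributivity bounds [a] by [(z \/ c) /\ (z \/ e) = z \/ (c /\ e)], which lies in [M]. *)
  pose z := ((x `|` y) `|` b)%O.
  have Mz : M (z `|` (c `&` e))%O.
    by exact: (MU _ _ (MU _ _ (MU _ _ Mx My) Mb) Mce).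
  have /negP := Mn _ Mz; apply; apply: le_trans (leUl _ _).
  rewrite joinIr lexI; apply/andP; split.
    by apply: le_trans ax _; rewrite joinAC leU2 // leU2 // leUl.
  by apply: le_trans ay _; rewrite joinAC leU2 // leU2 // leUr.
exists (SigSub (mem_set Mprime)) => //= Ma.
by have /negP := Mn _ Ma; apply; exact: leUl.
Qed.

Definition spec_basic a : set (spec L) := [set q | ~ val q a].

(** If [a] is not below [b], some prime ideal contains [b] but not [a], and the two sets differ. *)
Lemma spec_basic_inj : injective spec_basic.
Proof.
move=> a b ab; apply/le_anti/andP; split; apply/negP => /negP.
  move=> /prime_ideal_separation [q qb nqa].
  by have : spec_basic a q by []; rewrite ab; exact.
move=> /prime_ideal_separation [q qa nqb].
by have : spec_basic b q by []; rewrite -ab; exact.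
Qed.

Lemma spec_basicI a b : spec_basic (a `&` b)%O = spec_basic a `&` spec_basic b.
Proof.
by apply/seteqP; split=> q; rewrite /spec_basic /= prime_ideal_meet not_orE.
Qed.

Lemma spec_basicU a b : spec_basic (a `|` b)%O = spec_basic a `|` spec_basic b.
Proof.
by apply/seteqP; split=> q; rewrite /spec_basic /= prime_ideal_join not_andE.
Qed.

Lemma spec_basic0 : spec_basic \bot%O = set0.
Proof. by apply/seteqP; split=> q //= /(_ (prime_ideal_bot q)). Qed.

Lemma spec_basic1 : spec_basic \top%O = setT.
Proof. by apply/seteqP; split=> q //= _; exact: prime_ideal_top. Qed.

Lemma spec_basic_plus_open a : plus_open (spec_basic a).
Proof.
(* The principal ideal of [a]. *)
exists [set b | (b <= a)%O].
  split=> [|b c /= ba ca|b c /= bc ca]; first exact: le0x.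
    by rewrite leUx ba.
  exact: le_trans ca.
apply/seteqP; split=> q /= nq; last first.
  by move=> qa; apply: nq => b /= /prime_ideal_le; apply.
by move=> /(_ a); rewrite /= lexx => /(_ isT).
Qed.

Lemma spec_basicC_minus_open a : minus_open (~` spec_basic a).
Proof.
apply: generated_open; exists a => //.
by apply/seteqP; split=> q; rewrite /spec_basic /family_minus /setC /= notE.
Qed.

End PrimeIdeals.

(** * The sublattice generated by a subset *)

Section GeneratedSublattice.
Context {d : Order.disp_t} (L : tbDistrLatticeType d) (G : set L).

Let GL : set L := smallest (@is_sublattice01 _ L) G.

Definition generated_sublattice : Type := GL.

Lemma smallest_sublattice01 : is_sublattice01 GL.
Proof.
split=> [A [[]]|A [[]]|a b Ga Gb A hA|a b Ga Gb A hA] //.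
  by have [[_ _ AI _] _] := hA; apply: AI; [exact: Ga|exact: Gb].
by have [[_ _ _ AU] _] := hA; apply: AU; [exact: Ga|exact: Gb].
Qed.

HB.instance Definition _ := SubChoice.copy generated_sublattice GL.

Fact generated_sublattice_meet_closed : meet_closed (mem GL).
Proof.
have [_ _ GI _] := smallest_sublattice01.
by move=> a b Ga Gb; exact: mem_set (GI _ _ (set_mem Ga) (set_mem Gb)).
Qed.

Fact generated_sublattice_join_closed : join_closed (mem GL).
Proof.
have [_ _ _ GU] := smallest_sublattice01.
by move=> a b Ga Gb; exact: mem_set (GU _ _ (set_mem Ga) (set_mem Gb)).
Qed.

Fact generated_sublattice_bot : \bot%O \in mem GL.
Proof. by have [G0 _ _ _] := smallest_sublattice01; exact: mem_set. Qed.

Fact generated_sublattice_top : \top%O \in mem GL.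
Proof. by have [_ G1 _ _] := smallest_sublattice01; exact: mem_set. Qed.

HB.instance Definition _ := Order.SubChoice_isTBSubLattice.Build
  d L (mem GL) d generated_sublattice
  generated_sublattice_meet_closed generated_sublattice_join_closed
  generated_sublattice_bot generated_sublattice_top.

Fact generated_sublattice_meetUl :
  left_distributive (@Order.meet d generated_sublattice) Order.join.
Proof. by move=> a b c; apply/val_inj; exact: meetUl. Qed.

HB.instance Definition _ := Order.Lattice_Meet_isDistrLattice.Build
  d generated_sublattice generated_sublattice_meetUl.

End GeneratedSublattice.

(** * Induction on generators *)

Section GenerationTheory.
Context {d d' : Order.disp_t} (L : tbDistrLatticeType d)
  (L' : tbDistrLatticeType d').

Lemma lattice_generated_ind (G A : set L) :
  lattice_generated_by G -> is_sublattice01 A -> G `<=` A -> forall a, A a.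
Proof.
move=> genG subA GA a; have : [set: L] a by [].
by rewrite -genG; exact: smallest_sub.
Qed.

(** The elements on which [l1] and [l2] agree form a sublattice containing the generators. *)
Lemma lattice_hom_unique (X : Type) (phi : X -> L) (l1 l2 : L -> L') :
  lattice_generated_by (range phi) -> lattice_hom l1 -> lattice_hom l2 ->
  l1 \o phi = l2 \o phi -> l1 = l2.
Proof.
move=> genphi [l10 l11 l1I l1U] [l20 l21 l2I l2U] l12.
apply/funext.
apply: (lattice_generated_ind (A := [set a | l1 a = l2 a]) genphi).
  split=> /=; [by rewrite l10|by rewrite l11|..] => a b /= ea eb.
    by rewrite l1I l2I ea eb.
  by rewrite l1U l2U ea eb.
by move=> _ [x _ <-]; exact: (congr1 (@^~ x) l12).
Qed.

End GenerationTheory.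

(** * The lattice of subsets of [S] and its points *)

Section Representation.
Context {X : Type} (S : set (set X)).

(** Under [SP2] its members are exactly the sets in [Lplus], by [points_clopen] and
    [clopen_points]. *)
Definition clopen_lattice : tbDistrLatticeType set_display :=
  generated_sublattice (range (@family_plus X S)).

Definition points (u : clopen_lattice) : set (family_bitop S) := val u.

Definition clopen_of (x : X) : clopen_lattice :=
  SigSub (mem_set (sub_gen_smallest (imageT (@family_plus X S) x))).

Lemma points_inj : injective points.
Proof. exact: val_inj. Qed.

Lemma points_clopen_of x : points (clopen_of x) = family_plus x.
Proof. by []. Qed.

Lemma points0 : points \bot%O = set0. Proof. by []. Qed.

Lemma points1 : points \top%O = setT. Proof. by []. Qed.

Lemma pointsI u v : points (u `&` v)%O = points u `&` points v.
Proof. by []. Qed.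

Lemma pointsU u v : points (u `|` v)%O = points u `|` points v.
Proof. by []. Qed.

Lemma le_points u v : (u <= v)%O -> points u `<=` points v.
Proof. by move=> /meet_idPl uv p; rewrite -uv pointsI => -[]. Qed.

(** Generation in the power set passes to the subtype: [points] maps a sublattice of
    [clopen_lattice] onto a sublattice of the power set. *)
Lemma clopen_lattice_generated : lattice_generated_by (range clopen_of).
Proof.
apply/seteqP; split=> // u _ A [[A0 A1 AI AU] GA].
have : [set points v | v in A] (points u).
  apply: (set_mem (valP u)); split; last first.
    by move=> _ [x _ <-]; exists (clopen_of x) => //; apply: GA; exists x.
  split; [by exists \bot%O|by exists \top%O|..] => _ _ [a Aa <-] [b Ab <-].
    by exists (a `&` b)%O => //; exact: AI.
  by exists (a `|` b)%O => //; exact: AU.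
by move=> [v Av /points_inj <-].
Qed.

Lemma points_clopen u : plus_open (points u) /\ minus_open (~` points u).
Proof.
pose A : set clopen_lattice :=
  [set u | plus_open (points u) /\ minus_open (~` points u)].
apply: (lattice_generated_ind (A := A) clopen_lattice_generated).
  split=> [||a b [ao ac] [bo bc]|a b [ao ac] [bo bc]]; rewrite /A /=.
  - by rewrite points0 setC0; split; [exact: open0|exact: openT].
  - by rewrite points1 setCT; split; [exact: openT|exact: open0].
  - by rewrite pointsI setCI; split; [exact: openI|exact: openU].
  - by rewrite pointsU setCU; split; [exact: openU|exact: openI].
move=> _ [x _ <-]; rewrite /A /= points_clopen_of.
split; apply: generated_open; first by exists x.
by exists x => //; apply/seteqP; split=> p; rewrite /family_plus /setC /= notE.
Qed.

Lemma point_ideal_prime (p : family_bitop S) :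
  is_prime_ideal [set u : clopen_lattice | ~ points u p].
Proof.
split=> [||a b]; rewrite /= ?pointsI ?not_andE //; last by exact.
split=> [|a b|a b /le_points ab] /=; rewrite ?points0 ?pointsU ?not_orE //.
by move=> nb /ab.
Qed.

Definition point_ideal (p : family_bitop S) : spec clopen_lattice :=
  SigSub (mem_set (point_ideal_prime p)).

(** * Compactness: prime ideals are points *)

Section Compact.
Hypothesis S_compact : SP2 (family_bitop S).

(* Otherwise the sets [points u], [u \in q], and the complements of the sets
   [points u], [u \notin q], cover [S]; two applications of compactness show
   that finitely many of them do. *)
Lemma prime_ideal_point (q : spec clopen_lattice) :
  exists p : family_bitop S, point_ideal p = q.
Proof.
suff [p pq] : exists p : family_bitop S,
    forall u : clopen_lattice, ~ points u p <-> val q u.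
  by exists p; apply/val_inj/seteqP; split=> u /pq.
apply: contrapT => Nq.
pose Q : set (family_bitop S) := \bigcup_(u in val q) points u.
have Qo : plus_open Q.
  by apply: (@bigcup_open (plusT (family_bitop S))) => u _;
     have [] := points_clopen u.
(* The complement of [Q] is plus-closed, hence minus-compact; this yields one [w] outside [q] with
   [points w] inside [Q]. *)
have [V [w nqw <-] sV] : exists2 V : set (family_bitop S),
    [set ~` points u | u in ~` val q] V & ~` Q `<=` V.
  apply: (@cover_compact_directed (minusT (family_bitop S))).
  - by have [+ _] := S_compact (~` Q); rewrite setCK; exact.
  - by exists \top%O; rewrite ?points1 ?setCT //; exact: prime_ideal_top.
  - move=> _ _ [u nqu <-] [v nqv <-]; exists (u `&` v)%O.
      by move=> /prime_ideal_meet[].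
    by rewrite pointsI setCI.
  - by move=> _ [u _ <-]; have [] := points_clopen u.
  - move=> p nQp; apply: contrapT => Np; apply: Nq; exists p => u; split.
      move=> nup; apply: contrapT => nqu; apply: Np.
      by exists (~` points u) => //; exists u.
    by move=> qu up; apply: nQp; exists u.
(* Now [points w] is minus-closed, hence plus-compact, and one [v] in [q] suffices to cover it; so
   [w <= v], which forces [w] into [q]. *)
have [V' [v qv <-] sV'] : exists2 V' : set (family_bitop S),
    [set points u | u in val q] V' & points w `<=` V'.
  apply: (@cover_compact_directed (plusT (family_bitop S))).
  - by have [_ +] := S_compact (points w); apply; have [] := points_clopen w.
  - by exists \bot%O => //; exact: prime_ideal_bot.
  - by move=> _ _ [u qu <-] [v qv <-]; exists (u `|` v)%O;
       first exact/prime_ideal_join.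
  - by move=> _ [u _ <-]; have [] := points_clopen u.
  - move=> p wp; apply: contrapT => Np.
    apply: (sV p) => // -[u qu up].
    by apply: Np; exists (points u) => //; exists u.
apply: nqw; apply: prime_ideal_le qv; apply/meet_idPl/points_inj.
by rewrite pointsI; apply/setIidPl.
Qed.

Lemma preimage_point_ideal p : clopen_of @^-1` val (point_ideal p) = val p.
Proof.
by apply/seteqP; split=> x /=; rewrite points_clopen_of /family_plus /= notE.
Qed.

Lemma clopen_of_preimages : preimages_in S clopen_of.
Proof.
move=> q; have [p <-] := prime_ideal_point q.
by rewrite preimage_point_ideal; exact: set_mem (valP p).
Qed.

Let Phi := preimage_map clopen_of_preimages.

Lemma point_idealK : cancel point_ideal Phi.
Proof. by move=> p; apply/val_inj; exact: preimage_point_ideal. Qed.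

Lemma spec_clopen_lattice_isomorphism : S_isomorphism Phi.
Proof.
split; last first.
  exists point_ideal; split; [|exact: point_idealK|split].
  - by move=> q; have [p <-] := prime_ideal_point q; rewrite point_idealK.
  - apply/continuousP => _ [I _ ->].
    (* The ideal [point_ideal p] fails to contain [I] exactly when [p] lies in some member of
       [I]. *)
    suff -> : point_ideal @^-1` stone_set I = \bigcup_(u in I) points u.
      by apply: bigcup_open => u _; have [] := points_clopen u.
    apply/seteqP; split=> p /=.
      move=> nI; apply: contrapT => nU; apply: nI => u Iu /= up.
      by apply: nU; exists u.
    by move=> [u Iu up] /(_ u Iu).
  - apply: continuous_to_generated => _ [u _ <-].
    by have [] := points_clopen u.
split; apply: continuous_to_generated => _ [x _ <-].
  exact: (spec_basic_plus_open (clopen_of x)).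
by apply: generated_open; exists (clopen_of x).
Qed.

(* Stone-openness of [Phi^-1 W] already exhibits [W] as a union of members of
   the lattice. *)
Lemma clopen_points (W : set (family_bitop S)) :
  plus_open W -> minus_open (~` W) -> exists u, points u = W.
Proof.
move=> Wo Wc.
have [[/continuousP Phi_plus _] _] := spec_clopen_lattice_isomorphism.
have [I [I0 IU Id] WI] := Phi_plus _ Wo.
have WE p : W p <-> exists2 u, I u & points u p.
  (* Writing [p] as [Phi (point_ideal p)] turns membership in [W] into membership in the Stone set
     of [I]. *)
  rewrite -[in W p](point_idealK p) -[W _]/((Phi @^-1` W) (point_ideal p)).
  rewrite WI; split=> [nI|[u Iu up] /(_ u Iu)//].
  by apply: contrapT => nU; apply: nI => u Iu /= up; apply: nU; exists u.
have [V [u Iu <-] WV] : exists2 V : set (family_bitop S),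
    [set points u | u in I] V & W `<=` V.
  apply: (@cover_compact_directed (plusT (family_bitop S))).
  - by have [_ +] := S_compact W; exact.
  - by exists \bot%O.
  - by move=> _ _ [a Ia <-] [b Ib <-]; exists (a `|` b)%O => //; exact: IU.
  - by move=> _ [u _ <-]; have [] := points_clopen u.
  - by move=> p /WE[u Iu up]; exists (points u) => //; exists u.
by exists u; apply/seteqP; split=> // p up; apply/WE; exists u.
Qed.

End Compact.

(** * Universal property and comparison of representations *)

Section UniversalProperty.
Context {d : Order.disp_t} (L : tbDistrLatticeType d) (theta : X -> L)
  (htheta : preimages_in S theta).

Let Theta := preimage_map htheta.

(** The [u] with basic preimage form a sublattice containing the generators; injectivity of
    [spec_basic] makes the chosen [l] a homomorphism. *)
Lemma preimage_hom_exists : exists l : clopen_lattice -> L,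
  [/\ lattice_hom l, l \o clopen_of = theta
    & forall u, Theta @^-1` points u = spec_basic (l u)].
Proof.
have basic u : exists a : L, Theta @^-1` points u = spec_basic a.
  pose A : set clopen_lattice :=
    [set u | exists a : L, Theta @^-1` points u = spec_basic a].
  apply: (lattice_generated_ind (A := A) clopen_lattice_generated).
    split=> [||u1 u2 [a1 e1] [a2 e2]|u1 u2 [a1 e1] [a2 e2]].
    - by exists \bot%O; rewrite points0 preimage_set0 spec_basic0.
    - by exists \top%O; rewrite points1 preimage_setT spec_basic1.
    - by exists (a1 `&` a2)%O; rewrite pointsI preimage_setI e1 e2 spec_basicI.
    - by exists (a1 `|` a2)%O; rewrite pointsU preimage_setU e1 e2 spec_basicU.
  by move=> _ [x _ <-]; exists (theta x).
have [l lE] := choice basic; exists l; split=> //.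
  split=> [||u v|u v]; apply: spec_basic_inj; rewrite -lE.
  - by rewrite points0 preimage_set0 spec_basic0.
  - by rewrite points1 preimage_setT spec_basic1.
  - by rewrite pointsI preimage_setI !lE spec_basicI.
  - by rewrite pointsU preimage_setU !lE spec_basicU.
by apply/funext => x; apply: spec_basic_inj; rewrite -lE.
Qed.

Lemma preimage_hom_unique :
  exists! l : clopen_lattice -> L, lattice_hom l /\ l \o clopen_of = theta.
Proof.
have [l [lhom ltheta _]] := preimage_hom_exists.
exists l; split=> // l' [l'hom l'theta].
apply: lattice_hom_unique clopen_lattice_generated lhom l'hom _.
by rewrite ltheta.
Qed.

Lemma preimage_iso_unique :
  SP2 (family_bitop S) -> S_isomorphism Theta ->
  exists! l : clopen_lattice -> L, lattice_iso l /\ l \o clopen_of = theta.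
Proof.
move=> S_compact [_ [Psi [ThetaK PsiK]]].
move=> [/continuousP Psi_plus /continuousP Psi_minus].
have [l [lhom ltheta lE]] := preimage_hom_exists.
have PsiE u : Psi @^-1` spec_basic (l u) = points u.
  by rewrite -lE; apply/seteqP; split=> p; rewrite /= PsiK.
(* Continuity of [Psi] makes this set plus-open and minus-closed; the resulting choice [r] inverts
   [l]. *)
have clopen_basic a : exists u, points u = Psi @^-1` spec_basic a.
  apply: (clopen_points S_compact).
    by apply: Psi_plus; exact: spec_basic_plus_open.
  by apply: (Psi_minus (~` spec_basic a)); exact: spec_basicC_minus_open.
have [r rE] := choice clopen_basic.
have lbij : bijective l.
  exists r => [u|a]; first by apply: points_inj; rewrite rE PsiE.
  apply: spec_basic_inj; rewrite -lE rE.
  by apply/seteqP; split=> q; rewrite /= ThetaK.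
exists l; split=> // l' [[l'hom _] l'theta].
apply: lattice_hom_unique clopen_lattice_generated lhom l'hom _.
by rewrite ltheta.
Qed.

End UniversalProperty.

(** Equality of [clopen_of x] and [clopen_of y] means that the same points of [S] avoid [x] and
    [y]. *)
Lemma clopen_of_injective :
  injective clopen_of <->
  forall x y : X, x <> y ->
    exists2 p : set X, S p & (p x /\ ~ p y) \/ (~ p x /\ p y).
Proof.
split=> [inj x y xy|sep x y xyE].
  apply: contrapT => Np; apply: xy; apply: inj; apply: points_inj.
  rewrite !points_clopen_of; apply/seteqP; split=> p /= np pz; apply: Np;
    by exists (val p); [exact: set_mem (valP p)|by [right|left]].
apply: contrapT => /sep [p Sp pxy].
have : points (clopen_of x) (SigSub (mem_set Sp)) <->
       points (clopen_of y) (SigSub (mem_set Sp)) by rewrite xyE.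
by rewrite !points_clopen_of /family_plus /=; case: pxy => -[]; tauto.
Qed.

End Representation.

Theorem theorem2p4p1 (X : Type) (S : set (set X))
    (hS : abstract_spectrum (family_bitop S)) :
  exists (d : Order.disp_t) (L : tbDistrLatticeType d) (phi : X -> L),
    [/\ (* (i) *)
        lattice_generated_by (range phi),
        (* (ii), (iii) *)
        exists hphi : preimages_in S phi, S_isomorphism (preimage_map hphi),
        (* (iv) *)
        forall (d' : Order.disp_t) (L' : tbDistrLatticeType d')
            (theta : X -> L') (htheta : preimages_in S theta),
          S_morphism (preimage_map htheta) ->
          exists! l : L -> L', lattice_hom l /\ l \o phi = theta,
        (* (v) *)
        forall (d1 : Order.disp_t) (L1 : tbDistrLatticeType d1)
            (phi1 : X -> L1) (hphi1 : preimages_in S phi1),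
          S_isomorphism (preimage_map hphi1) ->
          exists! l : L -> L1, lattice_iso l /\ l \o phi = phi1
      & (* (vi) *)
        injective phi <->
        forall x y : X, x <> y ->
          exists2 p : set X, S p & (p x /\ ~ p y) \/ (~ p x /\ p y)].
Proof.
have [_ _ S_compact _] := hS.
exists set_display, (clopen_lattice S), (clopen_of S); split.
- exact: clopen_lattice_generated.
- exists (clopen_of_preimages S_compact).
  exact: spec_clopen_lattice_isomorphism.
- by move=> d' L' theta htheta _; exact: preimage_hom_unique htheta.
- by move=> d1 L1 phi1 hphi1; exact: preimage_iso_unique.
- exact: clopen_of_injective.
Qed.
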